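(* Let $r\ge 1$, let $a_1,\dots,a_r,b_1,\dots,b_r$ be positive integers and let $q\in\mathbb{C}$ with $|q|<1$. Let $$g=g(t\mid a_1,\dots,a_r;b_1,\dots,b_r)=\frac{(q^{b_1}e^{a_1t}+1)\cdots(q^{b_r}e^{a_rt}+1)}{2^r}\in\mathcal{F},$$ and let $g'$ denote its derivative with respect to $t$. Then for all $n\ge 0$, $$E_{n+1,q}(x\mid a_1,\dots,a_r;b_1,\dots,b_r)=\left(x-\frac{g'}{g}\right)E_{n,q}(x\mid a_1,\dots,a_r;b_1,\dots,b_r),$$ where $x$ acts on polynomials as multiplication by $x$ and the formal power series $\frac{g'}{g}$ acts on polynomials in $x$ as a differential operator.
   Context: The multivariate $q$-Euler polynomials $E_{n,q}(x\mid a_1,\dots,a_r;b_1,\dots,b_r)$ are defined by the generating function $$\sum_{n=0}^{\infty}E_{n,q}(x\mid a_1,\dots,a_r;b_1,\dots,b_r)\frac{t^n}{n!}=\frac{2^r}{(q^{b_1}e^{a_1t}+1)\cdots(q^{b_r}e^{a_rt}+1)}e^{xt}.$$ $\mathcal{F}$ is the algebra of formal power series $f(t)=\sum_{k\ge0}c_k\frac{t^k}{k!}$ with $c_k\in\mathbb{C}$. Such a series acts on a polynomial $p(x)\in\mathbb{C}[x]$ as an operator through $t^kp(x)=p^{(k)}(x)=\frac{d^kp(x)}{dx^k}$, i.e. $f(t)p(x)=\sum_{k\ge0}\frac{c_k}{k!}p^{(k)}(x)$ (a finite sum). A series with nonzero constant term (such as $g$) is invertible in $\mathcal{F}$, so $\frac{g'}{g}\in\mathcal{F}$.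 *)

(* Defs.v *)
From HB Require Import structures.
From mathcomp Require Import all_boot all_order all_algebra.
From mathcomp Require Import boolp reals complex.
Set Implicit Arguments.
Unset Strict Implicit.
Unset Printing Implicit Defensive.
Import Order.TTheory GRing.Theory Num.Theory.
Local Open Scope ring_scope.

(* The series \sum_k f_k t^k is stored through its ordinary coefficients f_k;
   when it is written \sum_k c_k t^k / k!, one has c_k = k! f_k. *)
Record fps (A : Type) : Type := FPS { fps_coef : nat -> A }.

Notation "f ``_ n" := (fps_coef f n)
  (at level 3, n at level 2, left associativity, format "f ``_ n") : ring_scope.

Lemma fpsP (A : Type) (f g : fps A) : (forall n, f``_n = g``_n) -> f = g.
Proof. by case: f g => [f] [g] /= fg; congr FPS; apply: funext. Qed.

HB.instance Definition _ (A : Type) := gen_eqMixin (fps A).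
HB.instance Definition _ (A : Type) := gen_choiceMixin (fps A).

Definition fps_zero (A : zmodType) : fps A := FPS (fun=> 0).
Definition fps_opp (A : zmodType) (f : fps A) : fps A := FPS (fun n => - f``_n).
Definition fps_add (A : zmodType) (f g : fps A) : fps A :=
  FPS (fun n => f``_n + g``_n).

Lemma fps_addA (A : zmodType) : associative (@fps_add A).
Proof. by move=> f g h; apply: fpsP => n /=; rewrite addrA. Qed.
Lemma fps_addC (A : zmodType) : commutative (@fps_add A).
Proof. by move=> f g; apply: fpsP => n /=; rewrite addrC. Qed.
Lemma fps_add0 (A : zmodType) : left_id (@fps_zero A) (@fps_add A).
Proof. by move=> f; apply: fpsP => n /=; rewrite add0r. Qed.
Lemma fps_addN (A : zmodType) :
  left_inverse (@fps_zero A) (@fps_opp A) (@fps_add A).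
Proof. by move=> f; apply: fpsP => n /=; rewrite addNr. Qed.

HB.instance Definition _ (A : zmodType) := GRing.isZmodule.Build (fps A)
  (@fps_addA A) (@fps_addC A) (@fps_add0 A) (@fps_addN A).

Definition fpsC (A : zmodType) (c : A) : fps A :=
  FPS (fun n => if n == 0%N then c else 0).
Definition fps_one (A : comNzRingType) : fps A := fpsC 1.
Definition fps_mul (A : comNzRingType) (f g : fps A) : fps A :=
  FPS (fun n => \sum_(i < n.+1) f``_i * g``_(n - i)).

Definition fps_trunc (A : comNzRingType) (m : nat) (f : fps A) : {poly A} :=
  \poly_(i < m.+1) f``_i.

Lemma coef_fps_trunc (A : comNzRingType) (m n : nat) (f : fps A) :
  (n <= m)%N -> (fps_trunc m f)`_n = f``_n.
Proof. by move=> le_nm; rewrite coef_poly ltnS le_nm. Qed.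

Lemma coef_fps_mul (A : comNzRingType) (m n : nat) (f g : fps A) :
  (n <= m)%N -> (fps_mul f g)``_n = (fps_trunc m f * fps_trunc m g)`_n.
Proof.
move=> le_nm; rewrite coefM; apply: eq_bigr => i _.
rewrite !coef_fps_trunc //; first exact: leq_trans (leq_subr _ _) le_nm.
by apply: leq_trans le_nm; rewrite -ltnS.
Qed.

Lemma fps_mulC (A : comNzRingType) : commutative (@fps_mul A).
Proof.
by move=> f g; apply: fpsP => n; rewrite !(coef_fps_mul _ _ (leqnn n)) mulrC.
Qed.

Lemma fps_mulA (A : comNzRingType) : associative (@fps_mul A).
Proof.
move=> f g h; apply: fpsP => n.
transitivity ((fps_trunc n f * (fps_trunc n g * fps_trunc n h))`_n).
  rewrite coefM; apply: eq_bigr => i _.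
  rewrite coef_fps_trunc; last by rewrite -ltnS.
  by rewrite (@coef_fps_mul _ n) // leq_subr.
rewrite mulrA coefM; apply: eq_bigr => i _.
rewrite coef_fps_trunc ?leq_subr //.
by rewrite (@coef_fps_mul _ n) // -ltnS.
Qed.

Lemma fps_mul1 (A : comNzRingType) : left_id (@fps_one A) (@fps_mul A).
Proof.
move=> f; apply: fpsP => n /=.
rewrite big_ord_recl /= subn0 mul1r big1 ?addr0 // => i _.
by rewrite mul0r.
Qed.

Lemma fps_mulDl (A : comNzRingType) : left_distributive (@fps_mul A) +%R.
Proof.
move=> f g h; apply: fpsP => n /=; rewrite -big_split /=.
by apply: eq_bigr => i _; rewrite mulrDl.
Qed.

Lemma fps_one_neq0 (A : comNzRingType) : fps_one A != 0.
Proof.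
by apply/eqP => /(congr1 (fun f : fps A => f``_0)) /= /eqP; rewrite oner_eq0.
Qed.

HB.instance Definition _ (A : comNzRingType) :=
  GRing.Zmodule_isComNzRing.Build (fps A) (@fps_mulA A) (@fps_mulC A)
    (@fps_mul1 A) (@fps_mulDl A) (@fps_one_neq0 A).

(* [:: h_n; ...; h_0], the first n.+1 coefficients of 1 / f in reverse order *)
Fixpoint fps_inv_seq (A : comUnitRingType) (f : fps A) (n : nat) : seq A :=
  if n is m.+1 then
    let s := fps_inv_seq f m in
    (- ((f``_0)^-1 * \sum_(i < m.+1) f``_i.+1 * s`_i)) :: s
  else [:: (f``_0)^-1].

Definition fps_unit (A : comUnitRingType) : {pred fps A} :=
  fun f => f``_0 \is a GRing.unit.

(* As for every MathComp unit ring, f^-1 = f when f is not invertible. *)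
Definition fps_inv (A : comUnitRingType) (f : fps A) : fps A :=
  if f \in @fps_unit A then FPS (fun n => (fps_inv_seq f n)`_0) else f.

Lemma nth_fps_inv_seq (A : comUnitRingType) (f : fps A) (n i : nat) :
  (i <= n)%N -> (fps_inv_seq f n)`_i = (fps_inv_seq f (n - i))`_0.
Proof.
elim: n i => [|n IHn] [|i] //= le_in.
by rewrite IHn // subSS.
Qed.

Lemma fps_mulV (A : comUnitRingType) :
  {in @fps_unit A, left_inverse 1 (@fps_inv A) *%R}.
Proof.
move=> f Uf; rewrite mulrC /fps_inv Uf; apply: fpsP => -[|n] /=.
  by rewrite big_ord1 divrr.
rewrite big_ord_recl /= mulrN mulVKr // addrC.
apply/eqP; rewrite subr_eq0; apply/eqP; apply: eq_bigr => i _.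
by rewrite [(_ f n)`_i]nth_fps_inv_seq // -ltnS.
Qed.

Lemma fps_unitPl (A : comUnitRingType) (f g : fps A) :
  g * f = 1 -> fps_unit f.
Proof.
move=> /(congr1 (fun h : fps A => h``_0)) /=; rewrite big_ord1 => gf1.
by apply/unitrP; exists g``_0; rewrite [f``_0 * _]mulrC.
Qed.

Lemma fps_inv_out (A : comUnitRingType) :
  {in [predC @fps_unit A], @fps_inv A =1 id}.
Proof. by move=> f /negbTE Uf; rewrite /fps_inv Uf. Qed.

HB.instance Definition _ (A : comUnitRingType) :=
  GRing.ComNzRing_hasMulInverse.Build (fps A)
    (@fps_mulV A) (@fps_unitPl A) (@fps_inv_out A).

Definition fps_deriv (A : zmodType) (f : fps A) : fps A :=
  FPS (fun n => f``_n.+1 *+ n.+1).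

Definition fps_exp (A : comUnitRingType) (x : A) : fps A :=
  FPS (fun n => x ^+ n / n`!%:R).

(* The operator p |-> f(t) p with t^k p = p^(k): since f``_k = c_k / k!, this is
   \sum_k (c_k / k!) p^(k), whose terms vanish for k >= size p. *)
Definition fps_act (A : comNzRingType) (f : fps A) (p : {poly A}) : {poly A} :=
  \sum_(k < size p) f``_k *: p^`(k).

Definition qexp_prod (A : comUnitRingType) (r : nat) (a b : 'I_r -> nat)
    (q : A) : fps A :=
  \prod_(i < r) (fpsC (q ^+ b i) * fps_exp (a i)%:R + 1).

Definition gser (A : comUnitRingType) (r : nat) (a b : 'I_r -> nat)
    (q : A) : fps A :=
  qexp_prod a b q / 2 ^+ r.

(* A power series in t over C[x], the indeterminate x being 'X : {poly C}. *)
Definition qEuler_gf (C : fieldType) (r : nat) (a b : 'I_r -> nat) (q : C) :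
    fps {poly C} :=
  2 ^+ r / qexp_prod a b q%:P * fps_exp 'X.

(* E_{n,q}(x | a_1, ..., a_r; b_1, ..., b_r) is n! times the coefficient of t^n
   in the generating function. *)
Definition qEuler (C : fieldType) (r : nat) (a b : 'I_r -> nat) (q : C)
    (n : nat) : {poly C} :=
  (qEuler_gf a b q)``_n *+ n`!.

(* Main.v *)
Require Import Defs.
From HB Require Import structures.
From mathcomp Require Import all_boot all_order all_algebra.
From mathcomp Require Import boolp reals complex.
Import Order.TTheory GRing.Theory Num.Theory.
Local Open Scope ring_scope.

(** The exponential generating function of the polynomials E_n is
    F = e^(xt) / g(t), the general shape of the generating function of an Appell
    sequence, and the recurrence holds for every such sequence, whatever the
    invertible series g ([appell_rec]).

    Compare two expressions of the t-derivative F' of F.  The coefficient of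
    t^n in F' is n+1 times that of t^(n+1) in F, that is, E_(n+1) / n!; on the
    other hand the Leibniz rule gives F' = x F - (g'/g) F, since
    (1/g)' = - (g'/g) (1/g) ([fps_deriv_appell]).  It remains to see that
    multiplying F by a series u(t) amounts to letting the operator u(t) act on
    each coefficient of F ([appell_act]).  The reason is that differentiation in
    x multiplies F by t ([deriv_appell]): the k-th derivative of the coefficient
    of t^n is the coefficient of t^(n-k), or 0 if k > n.

    The series g is invertible because its constant term is, up to a power of 2,
    the product of the q^(b_i) + 1, and |q| < 1 with b_i > 0 prevents
    q^(b_i) = -1 ([qexp_prod_unit]). *)

(** * Coefficientwise maps, units and derivation of power series *)

Definition map_fps (A B : Type) (f : A -> B) (u : fps A) : fps B :=
  FPS (fun n => f u``_n).
Arguments map_fps {A B} f u.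

Section MapFps.
Variables (A B : comNzRingType) (f : {rmorphism A -> B}).

Lemma map_fps_is_additive : zmod_morphism (map_fps f).
Proof. by move=> u v; apply: fpsP => n /=; rewrite rmorphB. Qed.

Lemma map_fps_is_monoid_morphism : monoid_morphism (map_fps f).
Proof.
split=> [|u v]; apply: fpsP => n /=.
  by case: (n == 0)%N; rewrite ?rmorph1 ?rmorph0.
by rewrite rmorph_sum; apply: eq_bigr => i _; rewrite rmorphM.
Qed.

HB.instance Definition _ :=
  GRing.isZmodMorphism.Build (fps A) (fps B) (map_fps f) map_fps_is_additive.
HB.instance Definition _ :=
  GRing.isMonoidMorphism.Build (fps A) (fps B) (map_fps f)
    map_fps_is_monoid_morphism.

Lemma map_fpsC (c : A) : map_fps f (fpsC c) = fpsC (f c).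
Proof. by apply: fpsP => n /=; case: (n == 0)%N; rewrite ?rmorph0. Qed.

End MapFps.

Lemma map_fps_exp (A B : comUnitRingType) (f : {rmorphism A -> B}) (x : A) :
  (forall n, n`!%:R \is a @GRing.unit A) ->
  map_fps f (fps_exp x) = fps_exp (f x).
Proof.
move=> Ufact; apply: fpsP => n /=.
by rewrite rmorph_div // rmorphXn rmorph_nat.
Qed.

Lemma fps_unitE (A : comUnitRingType) (u : fps A) :
  (u \is a GRing.unit) = (u``_0 \is a GRing.unit).
Proof. by []. Qed.

Lemma coef0_fps_prod (A : comNzRingType) (I : Type) (s : seq I)
    (F : I -> fps A) :
  (\prod_(i <- s) F i)``_0 = \prod_(i <- s) (F i)``_0.
Proof.
by apply: (big_morph (fun u : fps A => u``_0)) => // u v /=; rewrite big_ord1.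
Qed.

Lemma coef_fpsCM (A : comNzRingType) (c : A) (u : fps A) (n : nat) :
  (fpsC c * u)``_n = c * u``_n.
Proof.
by rewrite /= big_ord_recl /= subn0 big1 ?addr0 // => i _; rewrite mul0r.
Qed.

(** The coefficients of a product up to a given degree only depend on the
    truncations of its factors, so the rule is inherited from polynomials. *)
Lemma fps_derivM (A : comNzRingType) (u v : fps A) :
  fps_deriv (u * v) = fps_deriv u * v + u * fps_deriv v.
Proof.
apply: fpsP => n.
have ctrunc (w : fps A) m : (m <= n.+1)%N -> (fps_trunc n.+1 w)`_m = w``_m.
  exact: coef_fps_trunc.
transitivity ((fps_trunc n.+1 u * fps_trunc n.+1 v)^`()`_n).
  by rewrite coef_deriv -(coef_fps_mul _ _ (leqnn _)).
rewrite derivM coefD /= !coefM; congr (_ + _); apply: eq_bigr => i _.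
  by rewrite coef_deriv !ctrunc ?ltnS ?(leqW (leq_subr _ _)) // -ltnS.
by rewrite coef_deriv !ctrunc ?ltnS ?leq_subr // leqW // -ltnS.
Qed.

Lemma fps_deriv1 (A : comNzRingType) : fps_deriv (1 : fps A) = 0.
Proof. by apply: fpsP => n /=; rewrite mul0rn. Qed.

(** Differentiate g * g^-1 = 1. *)
Lemma fps_derivV (A : comUnitRingType) (g : fps A) : g \is a GRing.unit ->
  fps_deriv g^-1 = - (fps_deriv g / g * g^-1).
Proof.
move=> Ug; apply: (mulrI Ug); apply/eqP.
rewrite mulrN -addr_eq0 [g * (_ * _)]mulrC divrK // addrC -fps_derivM.
by rewrite divrr // fps_deriv1.
Qed.

Lemma fps_deriv_exp (A : comUnitRingType) (x : A) :
  (forall n, n`!%:R \is a @GRing.unit A) ->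
  fps_deriv (fps_exp x) = fpsC x * fps_exp x.
Proof.
move=> Ufact; apply: fpsP => n; rewrite coef_fpsCM /=.
have Un1 : n.+1%:R \is a @GRing.unit A.
  by have:= Ufact n.+1; rewrite factS natrM unitrM => /andP[].
rewrite factS natrM invrM // exprS -[LHS]mulr_natr -!mulrA.
by rewrite mulVr // mulr1.
Qed.

Lemma map_fps_deriv (A B : comNzRingType) (f : {rmorphism A -> B}) (u : fps A) :
  map_fps f (fps_deriv u) = fps_deriv (map_fps f u).
Proof. by apply: fpsP => n /=; rewrite rmorphMn. Qed.

(** * Appell sequences *)

Section Appell.
Variable C : numFieldType.
Implicit Types (u h g : fps C) (n k : nat).

Local Notation lift := (map_fps polyC).

Lemma fact_unit n : n`!%:R \is a @GRing.unit C.
Proof. by rewrite unitfE pnatr_eq0 -lt0n fact_gt0. Qed.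

Lemma fact_unit_poly n : n`!%:R \is a @GRing.unit {poly C}.
Proof. by rewrite -(rmorph_nat polyC) rmorph_unit // fact_unit. Qed.

Definition appell_gf h : fps {poly C} := lift h * fps_exp 'X.

Lemma deriv_exp_coef0 : ((fps_exp 'X : fps {poly C})``_0)^`() = 0.
Proof. by rewrite /= expr0 invr1 mulr1 derivC. Qed.

Lemma deriv_exp_coefS n :
  ((fps_exp 'X : fps {poly C})``_n.+1)^`() = (fps_exp 'X)``_n.
Proof.
have polyVfact m : (m`!%:R)^-1 = ((m`!%:R)^-1)%:P :> {poly C}.
  by rewrite [RHS]rmorphV ?fact_unit // rmorph_nat.
rewrite /= !polyVfact -!['X^_ * _]mulrC !mul_polyC derivZ derivXn.
rewrite -scaler_nat scalerA factS natrM invfM mulrAC mulVf ?mul1r //.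
by rewrite pnatr_eq0.
Qed.

(** Only the factor e^(xt) involves x, and its x-derivative is t e^(xt). *)
Lemma deriv_appell h n :
  ((appell_gf h)``_n.+1)^`() = (appell_gf h)``_n.
Proof.
rewrite /= big_ord_recr /= subnn linearD /= linear_sum /=.
rewrite derivM derivC mul0r add0r deriv_exp_coef0 mulr0 addr0.
apply: eq_bigr => i _; rewrite derivM derivC mul0r add0r.
by rewrite subSn ?deriv_exp_coefS // -ltnS.
Qed.

Lemma deriv_appell0 h : ((appell_gf h)``_0)^`() = 0.
Proof.
by rewrite /= big_ord1 derivM derivC mul0r add0r deriv_exp_coef0 mulr0.
Qed.

Lemma derivn_appell h n k :
  ((appell_gf h)``_n)^`(k) = if (k <= n)%N then (appell_gf h)``_(n - k) else 0.
Proof.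
elim: k n => [|k IHk] [|n]; rewrite ?derivn0 ?subn0 // derivSn.
  by rewrite deriv_appell0 linear0.
by rewrite deriv_appell IHk ltnS subSS.
Qed.

(** The (n+1)-st derivative vanishes, and in characteristic 0 this bounds the
    degree by n. *)
Lemma size_appell h n : (size (appell_gf h)``_n <= n.+1)%N.
Proof.
have := derivn_appell h n n.+1; rewrite ltnn => /polyP dn0.
apply/leq_sizeP => j lt_nj; apply/eqP; have := dn0 (j - n.+1)%N.
rewrite coef_derivn coef0 subnKC // => /eqP; rewrite -mulr_natr mulf_eq0.
by rewrite pnatr_eq0 -[_ == 0%N]negbK -lt0n ffact_gt0 lt_nj orbF.
Qed.

(** The sum defining the action stops at the size of p; a longer range
    independent of p makes it comparable with a convolution. *)
Lemma fps_act_widen u (p : {poly C}) m : (size p <= m)%N ->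
  fps_act u p = \sum_(k < m) u``_k *: p^`(k).
Proof.
move=> le_pm; rewrite /fps_act (big_ord_widen m (fun k => u``_k *: p^`(k))) //.
rewrite big_mkcond; apply: eq_bigr => k _; case: ltnP => // le_pk.
by rewrite derivn_poly0 // scaler0.
Qed.

(** Both sides are the convolution of the coefficients of u and of the
    generating function, because d/dx lowers the index. *)
Lemma appell_act u h n :
  fps_act u (appell_gf h)``_n = (lift u * appell_gf h)``_n.
Proof.
rewrite (fps_act_widen _ _ _ (size_appell h n)); apply: eq_bigr => k _.
by rewrite derivn_appell -ltnS ltn_ord mul_polyC.
Qed.

Lemma fps_deriv_appell g : g \is a GRing.unit ->
  fps_deriv (appell_gf g^-1) =
    fpsC 'X * appell_gf g^-1 - lift (fps_deriv g / g) * appell_gf g^-1.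
Proof.
move=> Ug; rewrite fps_derivM -map_fps_deriv fps_derivV //.
rewrite fps_deriv_exp; last exact: fact_unit_poly.
rewrite rmorphN rmorphM mulNr -mulrA addrC.
by congr (_ - _); rewrite mulrCA.
Qed.

Lemma appell_rec g n : g \is a GRing.unit ->
  (appell_gf g^-1)``_n.+1 *+ n.+1 =
    'X * (appell_gf g^-1)``_n -
    fps_act (fps_deriv g / g) (appell_gf g^-1)``_n.
Proof.
move=> Ug; rewrite appell_act -coef_fpsCM.
exact: (congr1 (fun w : fps {poly C} => w``_n) (fps_deriv_appell g Ug)).
Qed.

End Appell.

Lemma fps_actMn (A : numFieldType) (u : fps A) (p : {poly A}) (m : nat) :
  fps_act u (p *+ m) = fps_act u p *+ m.
Proof.
have le_size : (size (p *+ m) <= size p)%N.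
  by rewrite -scaler_nat size_scale_leq.
rewrite (fps_act_widen _ _ _ _ le_size) /fps_act -sumrMnl.
by apply: eq_bigr => k _; rewrite derivnMn scalerMnr.
Qed.

(** * The multivariate q-Euler polynomials *)

Section QEuler.
Variables (C : numFieldType) (r : nat) (a b : 'I_r -> nat) (q : C).

Lemma map_qexp_prod :
  map_fps polyC (qexp_prod a b q) = qexp_prod a b q%:P.
Proof.
rewrite rmorph_prod; apply: eq_bigr => i _.
rewrite rmorphD rmorphM rmorph1 /=.
rewrite map_fpsC map_fps_exp; last exact: fact_unit.
by rewrite rmorphXn rmorph_nat.
Qed.

Lemma two_fps_unit : (2 : fps C) \is a GRing.unit.
Proof. by rewrite fps_unitE unitfE /= (pnatr_eq0 C 2). Qed.

Lemma qexp_prod_unit : (forall i, (0 < b i)%N) -> `|q| < 1 ->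
  qexp_prod a b q \is a GRing.unit.
Proof.
move=> hb hq; rewrite fps_unitE coef0_fps_prod unitfE.
apply/prodf_neq0 => i _ /=; rewrite big_ord1 /= divr1 mulr1 addr_eq0.
apply/negP => /eqP/(congr1 Num.norm) /eqP.
by rewrite normrN normr1 normrX lt_eqF // exprn_ilt1 // -lt0n.
Qed.

(** [qEuler_gf] inverts a product of power series over C[x]; the factors have
    constant coefficients in x, so this inverse is the image of the one over C,
    where 1 / g is taken. *)
Lemma qEuler_gf_appell : qexp_prod a b q \is a GRing.unit ->
  qEuler_gf a b q = appell_gf C (gser a b q)^-1.
Proof.
move=> Up; rewrite /qEuler_gf /appell_gf /gser.
have U2r : (2 ^+ r : fps C) \is a GRing.unit by rewrite unitrX ?two_fps_unit.
rewrite invrM ?unitrV // invrK rmorph_div // rmorphXn rmorph_nat.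
by rewrite /= map_qexp_prod.
Qed.

End QEuler.

Theorem theorem1 (R : realType) (r : nat) (hr : (0 < r)%N)
    (a b : 'I_r -> nat) (ha : forall i, (0 < a i)%N) (hb : forall i, (0 < b i)%N)
    (q : R[i]) (hq : `|q| < 1) (n : nat) :
  qEuler a b q n.+1 =
    'X * qEuler a b q n -
    fps_act (fps_deriv (gser a b q) / gser a b q) (qEuler a b q n).
Proof.
have Up := qexp_prod_unit _ _ a b q hb hq.
have Ug : gser a b q \is a GRing.unit.
  by rewrite unitrM Up unitrV unitrX // two_fps_unit.
rewrite /qEuler qEuler_gf_appell // fps_actMn mulrnAr.
by rewrite -mulrnBl -appell_rec // -mulrnA factS.
Qed.
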